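(* Let $k$ be a field of characteristic zero, let $K\subset K^*$ be a finite separable extension of algebraic function fields over $k$, let $\nu^*$ be a valuation of $K^*$ (trivial on $k$) and let $\nu=\nu^*|_K$. Assume that $\nu^*$ is a rational $0$-dimensional valuation and that $n=\mathrm{trdeg}_kK^*-\mathrm{trdeg}_kV_{\nu^*}/m_{\nu^*}=2$. Let $R$ and $S$ be algebraic local rings of $K$ and $K^*$ such that $S$ dominates $R$ and $\nu^*$ dominates $S$, and suppose that $R\to S$ is stable. Then the semigroup $S^S(\nu^* )=\{\nu^*(g)\mid g\in S\setminus\{0\}\}$ is a finitely generated module over the semigroup $S^R(\nu)=\{\nu(g)\mid g\in R\setminus\{0\}\}$; that is, there is a finite set $T\subset S^S(\nu^* )$ such that $S^S(\nu^* )=\bigcup_{\tau\in T}\left(\tau+S^R(\nu)\right)$.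
   Context: For a valuation $\nu$, $V_\nu$ is its valuation ring, $m_\nu$ the maximal ideal of $V_\nu$, $\Gamma_\nu$ its value group. $\nu$ is rational if $\Gamma_\nu$ is order isomorphic to a subgroup of $\mathbb Q$, and $0$-dimensional if $\mathrm{trdeg}_kV_\nu/m_\nu=0$. An algebraic local ring of $K$ is a local ring $R$ (maximal ideal $m_R$) which is essentially of finite type over $k$ and has quotient field $K$; $\nu$ dominates $R$ if $R\subset V_\nu$ and $m_\nu\cap R=m_R$; $S$ dominates $R$ if $R\subset S$ and $m_S\cap R=m_R$. Monoidal transform: $R\to R_1$, where $R_1$ is a local ring of the blowup of a regular prime ideal $P$ of $R$ (i.e. $R/P$ is regular); it is along $\nu$ if $V_\nu$ dominates $R_1$. Strongly monomial (for $n=2$ and $\nu^*$ rational $0$-dimensional): $R\to S$ is strongly monomial with respect to regular parameters $u,v$ in $R$ and $x,y$ in $S$ if $R,S$ are two-dimensional regular local rings and $u=\gamma_0x^t$, $v=y$ for some unit $\gamma_0\in S$ and positive integer $t$; its exponent matrix is $A=\begin{pmatrix}t&0\\0&1\end{pmatrix}$. $R\to S$ is strongly monomial if such parameters exist. Stable: $R\to S$ is stable if (1) $R\to S$ is strongly monomial, and (2) whenever $R\to R_1$ and $S\to S_1$ are (possibly empty) products of monoidal transforms along $\nu$ and $\nu^*$ respectively, with $S_1$ dominating $R_1$, and $R_1\to S_1$ is strongly monomial with respect to regular parameters $u_1,v_1$ in $R_1$ and $x_1,y_1$ in $S_1$, with exponent matrix $A_1$, one has: (2a) the homomorphism $\mathbb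 Z^2/A_1^t\mathbb Z^2\to\Gamma_{\nu^*}/\Gamma_\nu$, $(b_1,b_2)\mapsto[b_1\nu^*(x_1)+b_2\nu^*(y_1)]$, is an isomorphism ($A_1^t$ is the transpose); (2b) $V_{\nu^*}/m_{\nu^*}$ is the join $(V_\nu/m_\nu)(S_1/m_{S_1})$; (2c) $V_\nu/m_\nu$ and $S_1/m_{S_1}$ are linearly disjoint over $R_1/m_{R_1}$ in $V_{\nu^*}/m_{\nu^*}$. *)

(* Defs.v *)
From HB Require Import structures.
Set Warnings "-notation-overridden,-ambiguous-paths,-notation-incompatible-prefix".
Set Warnings "-redundant-canonical-projection,-projection-no-head-constant".
From mathcomp Require Import all_boot all_order all_algebra all_field.
From mathcomp Require Import ring_quotient.
From mathcomp Require Import boolp classical_sets cardinality.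
From mathcomp Require Import mpoly.

Set Implicit Arguments.
Unset Strict Implicit.
Unset Printing Implicit Defensive.

Import Order.TTheory GRing.Theory Num.Theory.
Local Open Scope classical_set_scope.
Local Open Scope quotient_scope.
Local Open Scope ring_scope.

Section Subrings.
Variable F : fieldType.
Implicit Types (A B I M P Q R : set F).

Definition is_subring A := GRing.subring_closed (fun x : F => x \in A).
Definition is_subfield A := GRing.divring_closed (fun x : F => x \in A).

Definition is_ideal R I :=
  [/\ I `<=` R, I 0, (forall a b, I a -> I b -> I (a + b)) &
      forall r a, R r -> I a -> I (r * a)].

Definition prime_ideal R P :=
  [/\ is_ideal R P, ~ P 1 &
      forall a b, R a -> R b -> P (a * b) -> P a \/ P b].

Definition maximal_ideal R I :=
  [/\ is_ideal R I, I <> R &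
      forall J, is_ideal R J -> I `<=` J -> J = I \/ J = R].

Definition ideal_span R (G : set F) := smallest (is_ideal R) G.

Definition local_ring R := is_subring R /\ exists! I, maximal_ideal R I.

(* Defined for every [R] as the union of all maximal ideals; it is the maximal
   ideal when [R] is local. *)
Definition max_ideal R := [set a | exists2 I, maximal_ideal R I & I a].

Definition dominates B A :=
  A `<=` B /\ max_ideal B `&` A = max_ideal A.

Definition is_unit_of R (a : F) := [/\ a != 0, R a & R a^-1].

Definition localization A M := [set a / b | a in A & b in M].

(** Regularity of [R / P], for [P] a prime ideal of a local ring [R], is
    expressed in [R] itself: the ideals of [R / P] are the [I / P], with [I] an
    ideal of [R] containing [P]. *)

Definition noetherian_quotient R P :=
  forall I, is_ideal R I -> P `<=` I ->
  exists2 s : seq F, [set` s] `<=` R & I = ideal_span R (P `|` [set` s]).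

Definition prime_chain R P (n : nat) :=
  exists2 p : 'I_n.+1 -> set F,
    (forall i, prime_ideal R (p i) /\ P `<=` p i) &
    {homo p : i j / (i < j)%N >-> i `<` j}.

Definition krull_dim_quotient R P (d : nat) :=
  prime_chain R P d /\ forall n, prime_chain R P n -> (n <= d)%N.

Definition regular_quotient R P (d : nat) :=
  [/\ local_ring R, prime_ideal R P, noetherian_quotient R P,
      krull_dim_quotient R P d &
      exists2 s : seq F, size s = d /\ [set` s] `<=` R &
        max_ideal R = ideal_span R (P `|` [set` s])].

Definition regular_local_ring R d := regular_quotient R [set 0] d.

Definition regular_prime R P := exists d, regular_quotient R P d.

Definition regular_parameters2 R (u v : F) :=
  regular_local_ring R 2 /\ max_ideal R = ideal_span R [set u; v].

(** The blowup of a prime [P] of [R] is covered by the affine charts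
    [Spec R[P / f]], for [f] a nonzero element of [P]. *)

Definition blowup_chart R P (f : F) :=
  smallest is_subring (R `|` [set p / f | p in P]).

Definition monoidal_transform R R1 :=
  exists P f Q, [/\ regular_prime R P, P f, f != 0,
    prime_ideal (blowup_chart R P f) Q &
    R1 = localization (blowup_chart R P f) (blowup_chart R P f `\` Q)].

(** Possibly empty products of monoidal transforms along the valuation with ring [V]. *)
Inductive monoidal_product (V : set F) : set F -> set F -> Prop :=
| MonoidalNil R : monoidal_product V R R
| MonoidalCons R R1 R2 : monoidal_transform R R1 -> dominates V R1 ->
    monoidal_product V R1 R2 -> monoidal_product V R R2.

End Subrings.

Section Extensions.
Variables (k F : fieldType) (f : k -> F).

Definition fg_algebra n (x : 'I_n -> F) : set F :=
  range (fun p : {mpoly k[n]} => mmap f x p).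

Definition function_field :=
  exists n (x : 'I_n -> F),
    [set a / b | a in fg_algebra x & b in fg_algebra x] = setT.

Definition ess_finite_type (R : set F) :=
  exists n (x : 'I_n -> F) (M : set F),
    [/\ M `<=` fg_algebra x, ~ M 0, M 1,
        (forall a b, M a -> M b -> M (a * b)) &
        R = localization (fg_algebra x) M].

Definition algebraic_local_ring (R : set F) :=
  [/\ local_ring R, ess_finite_type R & [set a / b | a in R & b in R] = setT].

Definition algebraically_independent n (x : 'I_n -> F) :=
  forall p : {mpoly k[n]}, mmap f x p = 0 -> p = 0.

Definition trdeg_is (d : nat) :=
  (exists x : 'I_d -> F, algebraically_independent x) /\
  forall n (x : 'I_n -> F), algebraically_independent x -> (n <= d)%N.

End Extensions.

Section Subfields.
Variable F : fieldType.
Implicit Types (A B C : set F).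

Definition lin_indep_over C n (x : 'I_n -> F) :=
  forall c : 'I_n -> F, (forall i, C (c i)) ->
  \sum_(i < n) c i * x i = 0 -> forall i, c i = 0.

Definition linearly_disjoint A B C :=
  forall n (x : 'I_n -> F), (forall i, A (x i)) ->
  lin_indep_over C x -> lin_indep_over B x.

Definition field_join A B := smallest (@is_subfield F) (A `|` B).

End Subfields.

HB.mixin Record isOrderedZmodule G of Num.POrderedZmodule G := {
  ozmod_le_total : total (fun x y : G => x <= y);
  ozmod_lerD2l : forall z x y : G, x <= y -> z + x <= z + y
}.

#[short(type="orderedZmodType")]
HB.structure Definition OrderedZmodule :=
  { G of Num.POrderedZmodule G & isOrderedZmodule G }.

(** The value at [0], conventionally infinite, is left unspecified. *)
Record valuation (F : fieldType) (G : orderedZmodType) := Valuation {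
  valuation_fun :> F -> G;
  valuationM : forall x y, x != 0 -> y != 0 ->
    valuation_fun (x * y) = valuation_fun x + valuation_fun y;
  valuationD : forall x y, x != 0 -> y != 0 -> x + y != 0 ->
    Order.min (valuation_fun x) (valuation_fun y) <= valuation_fun (x + y)
}.

Section ValuationRing.
Variables (F : fieldType) (G : orderedZmodType) (nu : valuation F G).

Definition valring : {pred F} := fun x => (x == 0) || (0 <= nu x).

Lemma valringE x : (x \in valring) = (x == 0) || (0 <= nu x).
Proof. by []. Qed.

Definition value_group : set G := [set nu x | x in [set x | x != 0]].

Definition value_semigroup (R : set F) : set G := [set nu g | g in R `\ 0].

Definition trivial_on (k : Type) (f : k -> F) :=
  forall c, f c != 0 -> nu (f c) = 0.

Definition rational_valuation :=
  exists2 f : G -> rat,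
    (forall a b, value_group a -> value_group b -> f (a + b) = f a + f b) &
    (forall a b, value_group a -> value_group b -> (f a <= f b) = (a <= b)).

Lemma valuation1 : nu 1 = 0.
Proof.
have /esym := valuationM nu (oner_neq0 F) (oner_neq0 F).
by rewrite mulr1 => /(canRL (addrK _)); rewrite subrr.
Qed.

Lemma valuationN1 : nu (- 1) = 0.
Proof.
have n0 : (- 1 : F) != 0 by rewrite oppr_eq0 oner_neq0.
have := valuationM nu n0 n0; rewrite mulrNN mulr1 valuation1 => e.
have [l|l] := orP (ozmod_le_total 0 (nu (-1))).
- apply/eqP; rewrite eq_le l andbT.
  by have := ozmod_lerD2l (nu (-1)) _ _ l; rewrite addr0 -e.
- apply/eqP; rewrite eq_le l /=.
  by have := ozmod_lerD2l (nu (-1)) _ _ l; rewrite addr0 -e.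
Qed.

Lemma valuationN x : nu (- x) = nu x.
Proof.
have [->|x0] := eqVneq x 0; first by rewrite oppr0.
by rewrite -mulN1r valuationM ?oppr_eq0 ?oner_neq0 // valuationN1 add0r.
Qed.

Lemma valring_subring : GRing.subring_closed valring.
Proof.
split=> [|x y|x y]; rewrite !valringE.
- by rewrite valuation1 lexx orbT.
- have [->|x0 /= hx] := eqVneq x 0; first by rewrite sub0r oppr_eq0 valuationN.
  have [->|y0 /= hy] := eqVneq y 0; first by rewrite subr0 hx orbT.
  have [//|d0 /=] := eqVneq (x - y) 0.
  apply: le_trans (valuationD nu x0 _ d0); last by rewrite oppr_eq0.
  by rewrite valuationN /Order.min; case: ifP.
- have [->|x0 /= hx] := eqVneq x 0; first by rewrite mul0r eqxx.
  have [->|y0 /= hy] := eqVneq y 0; first by rewrite mulr0 eqxx.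
  rewrite mulf_eq0 (negPf x0) (negPf y0) /= valuationM //.
  by apply: le_trans hx _; rewrite -[leLHS]addr0; apply: ozmod_lerD2l.
Qed.

HB.instance Definition _ := GRing.isSubringClosed.Build F valring valring_subring.

Record valring_type := ValringType {
  valring_val :> F;
  valring_valP : valring_val \in valring
}.

HB.instance Definition _ := [isSub for valring_val].
HB.instance Definition _ := [Choice of valring_type by <:].
HB.instance Definition _ := [SubChoice_isSubComNzRing of valring_type by <:].

Definition valring_max : {pred valring_type} :=
  fun x => (val x == 0) || (0 < nu (val x)).

Lemma valring_maxE x : (x \in valring_max) = (val x == 0) || (0 < nu (val x)).
Proof. by []. Qed.

Lemma valring_max_ideal : idealr_closed valring_max.
Proof.
split=> [||a x y]; rewrite !valring_maxE.
- by rewrite raddf0 eqxx.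
- by rewrite rmorph1 oner_eq0 valuation1 ltxx.
rewrite rmorphD rmorphM /=.
have := valP a; rewrite valringE.
set b : F := val a; set u : F := val x; set v : F := val y => ha hx hy.
have hau : (b * u == 0) || (0 < nu (b * u)).
  have [->|b0] := eqVneq b 0; first by rewrite mul0r eqxx.
  have [->|u0] := eqVneq u 0; first by rewrite mulr0 eqxx.
  move: ha hx; rewrite (negPf b0) (negPf u0) /= => ha hx.
  rewrite mulf_eq0 (negPf b0) (negPf u0) /= valuationM //.
  rewrite addrC (lt_le_trans hx) // -[leLHS]addr0; exact: ozmod_lerD2l.
have [bu0|bu0] := eqVneq (b * u) 0; first by rewrite bu0 add0r.
have [->|v0] := eqVneq v 0; first by rewrite addr0.
have [//|d0 /=] := eqVneq (b * u + v) 0.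
move: hau hy; rewrite (negPf bu0) (negPf v0) /= => hau hy.
by apply: lt_le_trans (valuationD nu bu0 v0 d0); rewrite /Order.min; case: ifP.
Qed.

HB.instance Definition _ :=
  isIdealr.Build valring_type valring_max valring_max_ideal.

Definition residue_field := {ideal_quot valring_max}.

HB.instance Definition _ := GRing.ComNzRing.on residue_field.

Lemma residue_field_inv (a : residue_field) :
  a != 0 -> exists b : residue_field, b * a = 1.
Proof.
elim/quotW: a => x; rewrite -[0](rmorph0 (\pi_residue_field)).
rewrite -Quotient.idealrBE subr0 valring_maxE negb_or => /andP[x0 xN].
have := valP x; rewrite valringE (negPf x0) /= => xp.
have e0 : nu (val x) = 0.
  by apply/eqP; move: xp; rewrite le_eqVlt (negPf xN) orbF eq_sym.
have iP : (val x)^-1 \in valring.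
  rewrite valringE; apply/orP; right.
  have := valuationM nu x0 (invr_neq0 x0).
  by rewrite divff // valuation1 e0 add0r => <-.
exists (\pi_residue_field (ValringType iP)).
rewrite -rmorphM -[1](rmorph1 (\pi_residue_field)).
by congr (\pi _); apply: val_inj; rewrite rmorphM rmorph1 /= mulVf.
Qed.

Definition residue_inv (a : residue_field) : residue_field :=
  xget 0 [set b | b * a = 1].

Lemma residue_mulVf (a : residue_field) : a != 0 -> residue_inv a * a = 1.
Proof. by case/residue_field_inv => b ba; exact: (@xgetPex _ 0 [set c | c * a = 1] (ex_intro _ b ba)). Qed.

Lemma residue_inv0 : residue_inv 0 = 0.
Proof.
apply: xgetPN => b /=; rewrite mulr0 => /esym/eqP; exact/negP/oner_neq0.
Qed.

HB.instance Definition _ :=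
  GRing.ComNzRing_isField.Build residue_field residue_mulVf residue_inv0.

(** The residue map, extended by [0] outside the valuation ring. *)
Definition residue (x : F) : residue_field :=
  if insub x is Some y then \pi_residue_field (y : valring_type) else 0.

End ValuationRing.

Section Restriction.
Variables (F E : fieldType) (G : orderedZmodType).
Variables (j : {rmorphism F -> E}) (nu : valuation E G).

Let restrM (x y : F) : x != 0 -> y != 0 -> nu (j (x * y)) = nu (j x) + nu (j y).
Proof. by move=> x0 y0; rewrite rmorphM valuationM ?fmorph_eq0. Qed.

Let restrD (x y : F) : x != 0 -> y != 0 -> x + y != 0 ->
  Order.min (nu (j x)) (nu (j y)) <= nu (j (x + y)).
Proof.
by move=> x0 y0 d0; rewrite rmorphD valuationD -?rmorphD ?fmorph_eq0.
Qed.

Definition restrict_valuation : valuation F G :=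
  @Valuation F G (nu \o j) restrM restrD.

End Restriction.

Section Stable.
Variables (K Kstar : fieldType) (j : {rmorphism K -> Kstar}).

Definition strongly_monomial_wrt (R : set K) (S : set Kstar)
    (u v : K) (x y : Kstar) (t : nat) :=
  [/\ regular_parameters2 R u v, regular_parameters2 S x y, (0 < t)%N,
      (exists2 g0, is_unit_of S g0 & j u = g0 * x ^+ t) & j v = y].

Definition strongly_monomial (R : set K) (S : set Kstar) :=
  exists u v x y t, strongly_monomial_wrt R S u v x y t.

Definition exponent_matrix (t : nat) : 'M[int]_2 :=
  \matrix_(i, l) (if i == l then (if i == 0 then t%:Z else 1) else 0).

(** An additive [f] induces an isomorphism from [U / H] onto [G / G']. *)
Definition induces_iso (U V : zmodType) (f : U -> V)
    (H : set U) (G G' : set V) :=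
  [/\ forall b, G (f b),
      forall b, H b -> G' (f b),
      forall b, G' (f b) -> H b &
      forall g, G g -> exists b, G' (g - f b)].

Variables (G : orderedZmodType) (nustar : valuation Kstar G).
Let nu : valuation K G := restrict_valuation j nustar.

(* The residue field of a local ring [A] dominated by [nustar], as a subfield
   of the residue field of [nustar]. *)
Definition residue_image (A : set Kstar) : set (residue_field nustar) :=
  [set residue nustar a | a in A].

Definition stable (R : set K) (S : set Kstar) :=
  strongly_monomial R S /\
  forall (R1 : set K) (S1 : set Kstar) u1 v1 x1 y1 t1,
    monoidal_product [set` valring nu] R R1 ->
    monoidal_product [set` valring nustar] S S1 ->
    dominates S1 [set j a | a in R1] ->
    strongly_monomial_wrt R1 S1 u1 v1 x1 y1 t1 ->
    [/\ induces_iso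
          (fun b : 'cV[int]_2 => nustar x1 *~ b 0 0 + nustar y1 *~ b 1 0)
          [set (exponent_matrix t1)^T *m c | c in setT]
          (value_group nustar) (value_group nu),
        field_join (residue_image [set j a | a in [set` valring nu]])
                   (residue_image S1) = setT &
        linearly_disjoint (residue_image [set j a | a in [set` valring nu]])
                          (residue_image S1)
                          (residue_image [set j a | a in R1])].

End Stable.

(* Main.v *)
Require Import Defs.
From mathcomp Require Import all_boot all_order all_algebra all_field.
From mathcomp Require Import ring_quotient.
From mathcomp Require Import boolp classical_sets cardinality.
From mathcomp Require Import ring lra zify.

(** Let [u = g x^t] and [v = y] be strongly monomial parameters, and
    choose [e_1, .., e_n] in [S] whose residues form a basis of [S/m_S] over
    [R/m_R]; finiteness holds because, by linear disjointness, such
    elements are linearly independent over [K].  Since [m_S = (x, y)] and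
    [(x^t, y) = m_R S], iteration gives, for each [N],
    [s = sum_(i < t) x^i (sum_l r_il e_l) + h] with [r_il] in [R] and [h] in
    [m_R^N S].  The values are archimedean, so [h] does not affect the value of
    [s] for [N] large.  By linear disjointness the value of [sum_l r_il e_l] is
    the least value of the [r_il], and by (2a) the multiples [i nustar(x)],
    [i < t], are distinct modulo the value group of [nu], so no cancellation
    occurs between different powers of [x].  Hence [T = {i nustar(x) | i < t}]. *)

Set Implicit Arguments.
Unset Strict Implicit.
Unset Printing Implicit Defensive.

Import Order.TTheory GRing.Theory Num.Theory.
Local Open Scope classical_set_scope.
Local Open Scope ring_scope.

(** * Closure properties of subrings of a field *)

Section SubringClosure.
Variables (F : fieldType) (A : set F) (sA : is_subring A).

Lemma subring1 : A 1.
Proof. by case: sA => /set_mem. Qed.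

Lemma subringB x y : A x -> A y -> A (x - y).
Proof. by case: sA => _ h _ /mem_set Ax /mem_set Ay; exact/set_mem/h. Qed.

Lemma subringM x y : A x -> A y -> A (x * y).
Proof. by case: sA => _ _ h /mem_set Ax /mem_set Ay; exact/set_mem/h. Qed.

Lemma subring0 : A 0.
Proof. by rewrite -(subrr 1); apply: subringB; exact: subring1. Qed.

Lemma subringN x : A x -> A (- x).
Proof. by rewrite -sub0r; apply: subringB; exact: subring0. Qed.

Lemma subringD x y : A x -> A y -> A (x + y).
Proof. by move=> Ax Ay; rewrite -[y]opprK; apply/subringB/subringN. Qed.

Lemma subringX x n : A x -> A (x ^+ n).
Proof.
move=> Ax; elim: n => [|n IH]; first exact: subring1.
by rewrite exprS; apply: subringM.
Qed.

Lemma subring_sum (I : finType) (f : I -> F) :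
  (forall i, A (f i)) -> A (\sum_i f i).
Proof. by move=> Af; apply: big_ind => //; [exact: subring0|exact: subringD]. Qed.

End SubringClosure.

(** * Ideals of a subring, and maximal ideals through nonunits *)

Section MaximalIdeals.
Variables (F : fieldType) (A : set F) (sA : is_subring A).

Lemma principal_ideal a : A a -> is_ideal A [set r * a | r in A].
Proof.
move=> Aa; split.
- by move=> _ [r Ar <-]; apply: subringM.
- by exists 0; [exact: subring0|rewrite mul0r].
- by move=> _ _ [r Ar <-] [s As <-]; exists (r + s); rewrite ?mulrDl //;
  apply: subringD.
- by move=> r _ Ar [s As <-]; exists (r * s); rewrite ?mulrA//; apply: subringM.
Qed.

Lemma ideal_span2P x y a : A x -> A y -> ideal_span A [set x; y] a ->
  exists b c, [/\ A b, A c & a = b * x + c * y].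
Proof.
move=> Ax Ay; pose I := [set a | exists b c, [/\ A b, A c & a = b * x + c * y]].
have A0 := subring0 sA; have A1 := subring1 sA.
move: a; change (ideal_span A [set x; y] `<=` I); apply: smallest_sub.
  split.
  - by move=> _ [b [c [Ab Ac ->]]]; apply: subringD => //; apply: subringM.
  - by exists 0, 0; split; rewrite // !mul0r addr0.
  - move=> _ _ [b [c [Ab Ac ->]]] [b' [c' [Ab' Ac' ->]]].
    by exists (b + b'), (c + c'); split; [exact: subringD|exact: subringD|ring].
  - move=> r _ Ar [b [c [Ab Ac ->]]].
    by exists (r * b), (r * c); split; [exact: subringM|exact: subringM|ring].
move=> _ [->|->]; first by exists 1, 0; split; rewrite // mul1r mul0r addr0.
by exists 0, 1; split; rewrite // mul1r mul0r add0r.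
Qed.

Lemma ideal_has1 I : is_ideal A I -> I 1 -> I = A.
Proof.
move=> [IA _ _ IM] I1; apply/seteqP; split => // a Aa.
by rewrite -[a]mulr1; apply: IM.
Qed.

Lemma proper_ideal_maximal I : is_ideal A I -> ~ I 1 ->
  exists2 J, maximal_ideal A J & I `<=` J.
Proof.
move=> iI I1.
(* Zorn's lemma also tests the empty chain, whose union is empty; the guard [J !=set0] makes the
   property hold there. The maximal [M] is nonempty all the same, since otherwise [I] would be a
   larger set with the property. *)
pose P (J : set F) := J !=set0 -> [/\ is_ideal A J, I `<=` J & ~ J 1].
have [C FP tot|M [PM Mmax]] := @Zorn_bigcup _ P.
  move=> [z [X CX Xz]].
  have C0 Y w : C Y -> Y w -> [/\ is_ideal A Y, I `<=` Y & ~ Y 1].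
    by move=> CY Yw; apply: (FP Y CY); exists w.
  have [[_ X0 _ _] IX _] := C0 _ _ CX Xz.
  split; last by move=> [Y CY Y1]; have [] := C0 _ _ CY Y1.
    split.
    - by move=> w [Y CY Yw]; have [[YA _ _ _] _ _] := C0 _ _ CY Yw; exact: YA.
    - by exists X.
    - move=> a b [Y CY Ya] [Z CZ Zb].
      have [[_ _ YD _] _ _] := C0 _ _ CY Ya.
      have [[_ _ ZD _] _ _] := C0 _ _ CZ Zb.
      by case: (tot _ _ CY CZ) => sub;
        [exists Z => //; apply: ZD => //|exists Y => //; apply: YD => //];
        apply: sub.
    - move=> r a Ar [Y CY Ya]; exists Y => //.
      by have [[_ _ _ YM] _ _] := C0 _ _ CY Ya; apply: YM.
  by move=> w /IX Xw; exists X.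
have [M0|M0] := pselect (M !=set0); last first.
  suff /Mmax nPI : M `<` I by case: nPI => _; split.
  split; first by move=> w Mw; case: M0; exists w.
  by move=> sub; case: M0; exists 0; apply: sub; case: iI.
have [iM IM M1] := PM M0; exists M => //; split => //.
  by move=> MA; apply: M1; rewrite MA; exact: subring1.
move=> J iJ MJ.
have [/(ideal_has1 iJ)|J1] := pselect (J 1); first by right.
left; apply/seteqP; split => //; apply: contrapT => nJM.
apply: (Mmax J) => // _; split => //; exact: subset_trans IM MJ.
Qed.

(** An ideal containing a unit contains 1 and is not proper; conversely a nonunit generates a proper
    principal ideal, which Zorn's lemma places inside a maximal one. *)
Lemma max_idealP a : max_ideal A a <-> A a /\ ~ is_unit_of A a.
Proof.
split=> [[I [iI nI _] Ia]|[Aa nu]].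
  have [IA I0 _ IM] := iI; split; first exact: IA.
  move=> [a0 _ Ai]; apply: nI; apply: ideal_has1 => //.
  by rewrite -(mulVf a0); apply: IM.
have [|J mJ sub] := proper_ideal_maximal (principal_ideal Aa).
  move=> [r Ar ra]; apply: nu.
  have a0 : a != 0 by apply: contra_eq_neq ra => ->; rewrite mulr0 eq_sym oner_eq0.
  by split => //; rewrite -[a^-1]mul1r -ra mulfK.
by exists J => //; apply: sub; exists 1; [exact: subring1|rewrite mul1r].
Qed.

End MaximalIdeals.

(** * Linear independence and linear disjointness over a subfield *)

Section LinearDisjointness.
Variables (F : fieldType) (C : set F) (sC : is_subring C).
Hypothesis CV : forall c, C c -> C c^-1.

Definition in_span n (e : 'I_n -> F) (a : F) :=
  exists2 c : 'I_n -> F, (forall i, C (c i)) & a = \sum_i c i * e i.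

Definition fcons n (a : F) (e : 'I_n -> F) : 'I_n.+1 -> F :=
  fun i => oapp e a (unlift ord0 i).

Lemma fcons0 n a (e : 'I_n -> F) : fcons a e ord0 = a.
Proof. by rewrite /fcons unlift_none. Qed.

Lemma fconsS n a (e : 'I_n -> F) i : fcons a e (lift ord0 i) = e i.
Proof. by rewrite /fcons liftK. Qed.

Lemma fcons_ind n a (e : 'I_n -> F) (P : F -> Prop) :
  P a -> (forall i, P (e i)) -> forall i, P (fcons a e i).
Proof. by move=> Pa Pe i; rewrite /fcons; case: unlift. Qed.

Lemma fcons_sum n a c (e d : 'I_n -> F) :
  \sum_i fcons c d i * fcons a e i = c * a + \sum_i d i * e i.
Proof.
rewrite big_ord_recl !fcons0; congr (_ + _).
by apply: eq_bigr => i _; rewrite !fconsS.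
Qed.

(** If the coefficient of [a] in a relation were nonzero, dividing by it would express [a] through
    [e]. *)
Lemma lin_indep_fcons n (e : 'I_n -> F) a :
  lin_indep_over C e -> ~ in_span e a -> lin_indep_over C (fcons a e).
Proof.
move=> le na c Cc; rewrite big_ord_recl fcons0.
under eq_bigr do rewrite fconsS.
move=> s0.
have c0 : c ord0 = 0.
  apply: contrapT => /eqP c0; apply: na.
  exists (fun i => - (c ord0)^-1 * c (lift ord0 i)).
    by move=> i; apply: subringM => //; apply: subringN => //; apply: CV.
  under eq_bigr do rewrite -mulrA.
  rewrite -mulr_sumr mulNr; apply: (mulfI c0).
  by rewrite mulrN mulVKf //; apply/eqP; rewrite -addr_eq0 s0.
move: s0; rewrite c0 mul0r add0r => /le h i.
by case: (unliftP ord0 i) => [k ->|->] //; apply: h.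
Qed.

(** Running through the [a i] and keeping only those outside the span of the ones already kept
    leaves an independent family with the same span. *)
Lemma span_indep_basis (A : set F) n (a : 'I_n -> F) : (forall i, A (a i)) ->
  exists m (e : 'I_m -> F), [/\ forall i, A (e i), lin_indep_over C e &
    forall i, in_span e (a i)].
Proof.
elim: n a => [|n IH] a Aa.
  by exists 0, a; split => // [c _ _ []|[]].
have [m [e [Ae le ine]]] := IH (fun i => a (lift ord0 i)) (fun i => Aa _).
have [ina|nina] := pselect (in_span e (a ord0)).
  exists m, e; split=> // i.
  by case: (unliftP ord0 i) => [k ->|->].
exists m.+1, (fcons (a ord0) e); split; first exact: fcons_ind.
  exact: lin_indep_fcons.
move=> i; case: (unliftP ord0 i) => [k ->|->].
  have [c Cc ->] := ine k; exists (fcons 0 c).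
    by apply: fcons_ind => //; exact: subring0.
  by rewrite fcons_sum mul0r add0r.
exists (fcons 1 (fun=> 0)).
  by apply: fcons_ind => [|_]; [exact: subring1|exact: subring0].
by rewrite fcons_sum mul1r big1 ?addr0 // => k _; rewrite mul0r.
Qed.

(** The definition of [linearly_disjoint] treats its first two arguments differently, so symmetry
    has to be proved. In a relation among the [y i] with coefficients in [A], expand these
    coefficients in a [C]-basis [e] of their span, chosen in [A]. The [e l] stay independent over
    [B], so the factor of each [e l], a [C]-combination of the [y i], vanishes, and independence of
    [y] over [C] finishes. *)
Lemma linearly_disjoint_sym (A B : set F) : is_subring B -> C `<=` B ->
  linearly_disjoint A B C -> linearly_disjoint B A C.
Proof.
move=> sB CB ld n y By ly a Aa ay0.
have [m [e [Ae le ine]]] := span_indep_basis Aa.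
have {}le := ld _ _ Ae le.
have /choice[c ac] : forall i, exists c : 'I_m -> F,
    (forall l, C (c l)) /\ a i = \sum_l c l * e l.
  by move=> i; have [c] := ine i; exists c.
have c0 l : forall i, c i l = 0.
  apply: (ly (fun i => c i l)); first by move=> i; apply: (ac i).1.
  move: l; apply: le.
    move=> l; apply: subring_sum => // i.
    by apply: subringM => //; apply/CB/(ac i).1.
  rewrite -[RHS]ay0; under eq_bigr do rewrite mulr_suml.
  rewrite exchange_big; apply: eq_bigr => i _; rewrite (ac i).2 mulr_suml.
  by apply: eq_bigr => l _; rewrite mulrAC.
by move=> i; rewrite (ac i).2 big1 // => l _; rewrite c0 mul0r.
Qed.

End LinearDisjointness.

(** * Arithmetic of the residue map on the valuation ring *)

Section Residue.
Local Open Scope quotient_scope.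
Variables (F : fieldType) (G : orderedZmodType) (nu : valuation F G).

Lemma residueE x (Vx : x \in valring nu) :
  residue nu x = \pi_(residue_field nu) (ValringType Vx).
Proof. by rewrite /residue (insubT (fun x => x \in valring nu) Vx). Qed.

Lemma residue1 : residue nu 1 = 1.
Proof.
rewrite (residueE (rpred1 _)) -[RHS](rmorph1 (\pi_(residue_field nu))).
by congr (\pi _); apply: val_inj; rewrite rmorph1.
Qed.

Lemma residueB x y : x \in valring nu -> y \in valring nu ->
  residue nu (x - y) = residue nu x - residue nu y.
Proof.
move=> Vx Vy; rewrite (residueE Vx) (residueE Vy) (residueE (rpredB Vx Vy)).
by rewrite -rmorphB; congr (\pi _); apply: val_inj; rewrite rmorphB.
Qed.

Lemma residueM x y : x \in valring nu -> y \in valring nu ->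
  residue nu (x * y) = residue nu x * residue nu y.
Proof.
move=> Vx Vy; rewrite (residueE Vx) (residueE Vy) (residueE (rpredM Vx Vy)).
by rewrite -rmorphM; congr (\pi _); apply: val_inj; rewrite rmorphM.
Qed.

Lemma residue0 : residue nu 0 = 0.
Proof. by rewrite -(subrr 1) residueB ?rpred1 // subrr. Qed.

Lemma residueD x y : x \in valring nu -> y \in valring nu ->
  residue nu (x + y) = residue nu x + residue nu y.
Proof.
move=> Vx Vy; rewrite -[y in LHS]opprK residueB ?rpredN // -[- y]sub0r.
by rewrite residueB ?rpred0 // residue0 sub0r opprK.
Qed.

Lemma residue_sum n (x : 'I_n -> F) : (forall i, x i \in valring nu) ->
  residue nu (\sum_i x i) = \sum_i residue nu (x i).
Proof.
move=> Vx; pose P a b := a \in valring nu /\ residue nu a = b.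
suff [] : P (\sum_i x i) (\sum_i residue nu (x i)) by [].
apply: big_ind2 => [|a _ b _ [Va <-] [Vb <-]|i _]; rewrite /P.
- by rewrite rpred0 residue0.
- by rewrite rpredD // residueD.
- by rewrite Vx.
Qed.

Lemma residue_eq0 x : x \in valring nu ->
  (residue nu x == 0) = (x == 0) || (0 < nu x).
Proof.
move=> Vx; rewrite (residueE Vx) -[0](rmorph0 (\pi_(residue_field nu))).
by rewrite -Quotient.idealrBE subr0 valring_maxE.
Qed.

End Residue.

(** * Values read as rational numbers through an order embedding of the value group *)

Section RationalValuation.
Variables (F : fieldType) (G : orderedZmodType) (nu : valuation F G).
Variable f : G -> rat.
Hypothesis fD : forall a b,
  value_group nu a -> value_group nu b -> f (a + b) = f a + f b.
Hypothesis f_le : forall a b,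
  value_group nu a -> value_group nu b -> (f a <= f b) = (a <= b).

Local Notation w x := (f (nu x)).
Local Notation V := [set` valring nu].

Lemma value_groupP x : x != 0 -> value_group nu (nu x).
Proof. by exists x. Qed.

Lemma ratvalM x y : x != 0 -> y != 0 -> w (x * y) = w x + w y.
Proof. by move=> x0 y0; rewrite valuationM // fD //; exact: value_groupP. Qed.

Lemma ratval1 : w 1 = 0.
Proof.
have := ratvalM (oner_neq0 F) (oner_neq0 F); rewrite mulr1; lra.
Qed.

Lemma ratvalX x n : x != 0 -> w (x ^+ n) = w x *+ n.
Proof.
move=> x0; elim: n => [|n IH]; first by rewrite ratval1.
by rewrite exprS ratvalM ?expf_neq0 // IH mulrS.
Qed.

Lemma ratval_inj x y : x != 0 -> y != 0 -> w x = w y -> nu x = nu y.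
Proof.
move=> x0 y0 wxy; apply/eqP.
by rewrite eq_le -!f_le ?wxy ?lexx //; exact: value_groupP.
Qed.

Lemma ratvalV x : x != 0 -> w x^-1 = - w x.
Proof.
move=> x0; have := ratvalM x0 (invr_neq0 x0).
by rewrite divff // ratval1; lra.
Qed.

Lemma ratvalD x y c : x != 0 -> y != 0 -> x + y != 0 ->
  c <= w x -> c <= w y -> c <= w (x + y).
Proof.
move=> x0 y0 xy0 cx cy.
have := valuationD nu x0 y0 xy0; rewrite /Order.min.
case: ifP => _; rewrite -f_le; try exact: value_groupP.
  exact: le_trans cx.
exact: le_trans cy.
Qed.

(** The alternative [x = 0] stands for the infinite value of 0, which [valuation] leaves
    unspecified. *)
Definition val_ge c x := x = 0 \/ c <= w x.

Lemma val_geD c x y : val_ge c x -> val_ge c y -> val_ge c (x + y).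
Proof.
move=> [->|cx]; first by rewrite add0r.
move=> [->|cy]; first by rewrite addr0; right.
have [->|x0] := eqVneq x 0; first by rewrite add0r; right.
have [->|y0] := eqVneq y 0; first by rewrite addr0; right.
have [xy0|xy0] := eqVneq (x + y) 0; first by left.
by right; apply: ratvalD.
Qed.

Lemma val_geM c d x y : val_ge c x -> val_ge d y -> val_ge (c + d) (x * y).
Proof.
move=> [->|cx]; first by rewrite mul0r; left.
move=> [->|cy]; first by rewrite mulr0; left.
have [->|x0] := eqVneq x 0; first by rewrite mul0r; left.
have [->|y0] := eqVneq y 0; first by rewrite mulr0; left.
by right; rewrite ratvalM //; lra.
Qed.

(** If [x + y] had larger value than [x], then [x], as the difference of [x + y] and [y], would have
    value larger than its own. *)
Lemma ratval_addl x y : x != 0 -> y = 0 \/ w x < w y ->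
  x + y != 0 /\ w (x + y) = w x.
Proof.
move=> x0 [->|wxy]; first by rewrite addr0.
have [y0|y0] := eqVneq y 0; first by rewrite y0 addr0.
have xy0 : x + y != 0.
  apply: contraTneq wxy => /eqP; rewrite addr_eq0 => /eqP ->.
  by rewrite valuationN ltxx.
split=> //; apply/eqP; rewrite eq_le; apply/andP; split; last first.
  by apply: ratvalD => //; exact: ltW.
rewrite leNgt; apply/negP => h.
suff : Order.min (w y) (w (x + y)) <= w (x + y - y).
  by rewrite addrK ge_min; lra.
apply: ratvalD; rewrite ?oppr_eq0 ?addrK // ?valuationN.
  by rewrite ge_min lexx orbT.
by rewrite ge_min lexx.
Qed.

Lemma in_valring x : x \in valring nu <-> val_ge 0 x.
Proof.
have [->|x0] := eqVneq x 0; first by rewrite rpred0; split => // _; left.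
rewrite valringE (negPf x0) /= -(valuation1 nu).
rewrite -f_le; [|exact/value_groupP/oner_neq0|exact: value_groupP].
rewrite ratval1; split=> [h|[e|//]]; first by right.
by rewrite e eqxx in x0.
Qed.

Lemma is_subring_valring : is_subring V.
Proof.
split=> [|x y|x y]; rewrite !inE /=;
  [exact: rpred1|exact: rpredB|exact: rpredM].
Qed.

Lemma max_ideal_valring x : max_ideal V x <-> x = 0 \/ 0 < w x.
Proof.
rewrite max_idealP; last exact: is_subring_valring.
have [->|x0] := eqVneq x 0.
  by split=> _; [left|split; [exact: rpred0|case; rewrite eqxx]].
split=> [[/in_valring[e|x1] nu']|[e|x1]]; try by rewrite e eqxx in x0.
  right; rewrite lt_def x1 andbT; apply/eqP => w0; apply: nu'.
  split=> //; apply/in_valring; right; first by [].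
  by rewrite ratvalV // w0 oppr0.
split; first by apply/in_valring; right; exact: ltW.
move=> [_ _ /in_valring[/eqP|]]; first by rewrite invr_eq0 (negPf x0).
by rewrite ratvalV //; lra.
Qed.

Lemma residue_eq0P x : x \in valring nu ->
  residue nu x = 0 <-> x = 0 \/ 0 < w x.
Proof.
move=> Vx; have [->|x0] := eqVneq x 0.
  by rewrite residue0; split => // _; left.
have e : (0 < nu x) = (0 < w x).
  rewrite -ratval1 !lt_neqAle -(valuation1 nu) f_le;
    [|exact/value_groupP/oner_neq0|exact: value_groupP].
  congr (~~ _ && _); apply/eqP/eqP => [->//|]; apply: ratval_inj => //.
  exact: oner_neq0.
split=> [/eqP|[/eqP|h]]; rewrite ?(negPf x0) //.
  by rewrite residue_eq0 // (negPf x0) e; right.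
by apply/eqP; rewrite residue_eq0 // e h orbT.
Qed.

Lemma ratval_archimedean c x : 0 < c -> exists n, w x < c *+ n.
Proof.
move=> c0; exists (Num.bound `|w x / c|).
rewrite -mulr_natl -ltr_pdivrMr //.
by apply: le_lt_trans (ler_norm _) (archi_boundP _).
Qed.

(** By induction the sum of the tail has the value of one of its terms. This differs from the value
    of the head, so the smaller of the two dominates and nothing cancels. *)
Lemma distinct_values_sum (I : eqType) (s : seq I) (a : I -> F) : uniq s ->
  {in s &, forall i l, a i != 0 -> a l != 0 -> w (a i) = w (a l) -> i = l} ->
  (forall i, i \in s -> a i = 0) \/
  (exists2 i, i \in s &
    [/\ a i != 0, \sum_(i <- s) a i != 0 & w (\sum_(i <- s) a i) = w (a i)]).
Proof.
elim: s => [|i s IH] /=; first by left.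
move=> /andP[nis us] inj; rewrite big_cons.
have [|h0|[l ls [al0 s0 ws]]] := IH us.
- by move=> l k ls ks; apply: inj; rewrite inE ?ls ?ks orbT.
- have -> : \sum_(l <- s) a l = 0 by rewrite big_seq big1.
  rewrite addr0; have [ai0|ai0] := eqVneq (a i) 0.
    by left=> l; rewrite inE => /predU1P[->|/h0].
  by right; exists i; rewrite ?mem_head.
right; have [ai0|ai0] := eqVneq (a i) 0.
  by rewrite ai0 add0r; exists l; rewrite // inE ls orbT.
have [wil|wil|wil] := ltgtP (w (a i)) (w (a l)).
- exists i; first exact: mem_head.
  by have [] := @ratval_addl (a i) (\sum_(l <- s) a l) ai0 _; rewrite ?ws; [right|].
- exists l; first by rewrite inE ls orbT.
  rewrite addrC -ws.
  by have [] := @ratval_addl (\sum_(l <- s) a l) (a i) s0 _; rewrite ?ws; [right|].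
- move: nis; rewrite (inj i l) ?ls // ?mem_head //.
  by rewrite inE ls orbT.
Qed.

End RationalValuation.

(** * Regular parameters of a dominated two-dimensional ring are nonzero *)

Section RegularParameters.
Variables (F : fieldType) (G : orderedZmodType) (nu : valuation F G).
Variable f : G -> rat.
Hypothesis fD : forall a b,
  value_group nu a -> value_group nu b -> f (a + b) = f a + f b.
Hypothesis f_le : forall a b,
  value_group nu a -> value_group nu b -> (f a <= f b) = (a <= b).
Variable S : set F.
Hypothesis VS : dominates [set` valring nu] S.
Local Notation w x := (f (nu x)).

Lemma dominated_max_idealP x : max_ideal S x <-> S x /\ (x = 0 \/ 0 < w x).
Proof.
case: VS => _ <-; rewrite -(max_ideal_valring fD f_le).
by split=> [[]|[]].
Qed.

Lemma dominated_val_ge0 x : S x -> val_ge nu f 0 x.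
Proof. by case: VS => sub _ /sub/(in_valring fD f_le). Qed.

(* If [x = 0], the maximal ideal is [(y)], and as the values are archimedean
   every nonzero prime ideal contains [y]: the dimension is at most [1]. *)
Lemma regular_parameter_neq0 x y : regular_parameters2 S x y -> x != 0.
Proof.
move=> [[[sS _] _ _ [[p pP p_lt] _] _] mS].
apply/eqP => x0.
pose i0 : 'I_3 := ord0; pose i1 : 'I_3 := inord 1; pose i2 : 'I_3 := inord 2.
have [_ /existsNP[a /not_implyP[p1a p0a]]] : p i0 `<` p i1.
  by apply: p_lt; rewrite /i0 /i1 inordK.
have [_ p21] : p i1 `<` p i2 by apply: p_lt; rewrite /i2 /i1 !inordK.
have a0 : a != 0.
  by apply: contra_notN p0a => /eqP ->; have [[[]]] := pP i0.
have pm i : p i `<=` max_ideal S.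
  move=> b pb; have [[[pS _ _ pM] p1 _] _] := pP i.
  apply/(max_idealP sS); split; first exact: pS.
  by move=> [b0 _ /pM/(_ pb)]; rewrite mulVf.
have [mx my] : max_ideal S x /\ max_ideal S y.
  by rewrite mS; split; apply: sub_gen_smallest; [left|right].
have [Sx _] := (dominated_max_idealP x).1 mx.
have [Sy vy] := (dominated_max_idealP y).1 my.
have my_span b : max_ideal S b -> exists2 c, S c & b = c * y.
  rewrite mS => /(ideal_span2P sS Sx Sy)[c [d [_ Sd ->]]].
  by exists d; rewrite // x0 mulr0 add0r.
have y0 : y != 0.
  have [c _ e] := my_span _ (pm _ _ p1a).
  by apply: contra_neq a0 => y0; rewrite e y0 mulr0.
have wy : 0 < w y by case: vy => // e; rewrite e eqxx in y0.
have [[[pS _ _ pM] _ p_prime] _] := pP i1.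
have [n wan] := ratval_archimedean nu f a wy.
suff p1y : p i1 y.
  apply: p21 => b /pm/my_span[c Sc ->]; exact: pM.
(* Descent: in [a = c * y] primality puts [c] or [y] into [p i1], and the value of [c] is smaller by
   that of [y]. It cannot become negative, so [y] is reached eventually. *)
elim: n a p1a a0 wan {p0a} => [|n IH] a p1a a0 wan.
  case: (dominated_val_ge0 (pS _ p1a)) => [e|]; first by rewrite e eqxx in a0.
  by move: wan; rewrite mulr0n; lra.
have [c Sc e] := my_span _ (pm _ _ p1a).
have c0 : c != 0 by apply: contra_neq a0 => c0; rewrite e c0 mul0r.
have [p1c|//] : p i1 c \/ p i1 y by apply: p_prime => //; rewrite -e.
apply: (IH _ p1c c0); move: wan.
by rewrite e (ratvalM fD) // mulrSr; lra.
Qed.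

End RegularParameters.

(** * Expansion of elements of [S] with coefficients in [R] *)

Section Expansion.
Variables (K F : fieldType) (j : {rmorphism K -> F}).
Variables (R : set K) (S : set F).
Hypotheses (sR : is_subring R) (sS : is_subring S).
Variables (n : nat) (e : 'I_n -> F).

Definition comb (r : 'I_n -> K) := \sum_l j (r l) * e l.

Lemma combD r s : comb (fun l => r l + s l) = comb r + comb s.
Proof. by rewrite -big_split; apply: eq_bigr => l _; rewrite rmorphD mulrDl. Qed.

Lemma combZ a r : comb (fun l => a * r l) = j a * comb r.
Proof. by rewrite mulr_sumr; apply: eq_bigr => l _; rewrite rmorphM mulrA. Qed.

Variables x y : F.
(** This will hold because the residues of the [e l] span the residue field of [S] over that of [R],
    and [x], [y] generate the maximal ideal of [S]. *)
Hypothesis split_mod_max : forall s, S s -> exists r a b,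
  [/\ forall l, R (r l), S a, S b & s = comb r + a * x + b * y].

(** The digits of [s] in base [x] modulo [y]: each round splits the factor [a] of the last power of
    [x] once more and moves its multiple of [y] into [b]. *)
Lemma expand_mod m s : S y -> S x -> S s -> exists r : nat -> 'I_n -> K, exists a b,
  [/\ forall i l, R (r i l), S a, S b &
      s = \sum_(i < m) x ^+ i * comb (r i) + a * x ^+ m + b * y].
Proof.
move=> Sy Sx Ss; elim: m => [|m [r [a [b [Rr Sa Sb ->]]]]].
  exists (fun _ _ => 0), s, 0; split => //; try by move=> *; exact: subring0.
  by rewrite big_ord0 expr0; ring.
have [r' [a' [b' [Rr' Sa' Sb' ->]]]] := split_mod_max Sa.
exists (fun i => if i == m then r' else r i), a', (b' * x ^+ m + b).
split=> //.
- by move=> i l; case: ifP.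
- apply: subringD => //; apply: subringM => //; exact: subringX.
rewrite big_ord_recr /= eqxx.
under [in RHS]eq_bigr => i _ do rewrite ltn_eqF //.
rewrite exprS; ring.
Qed.

Variables (G : orderedZmodType) (nu : valuation F G) (f : G -> rat).
Hypothesis fD : forall a b,
  value_group nu a -> value_group nu b -> f (a + b) = f a + f b.
Hypothesis f_le : forall a b,
  value_group nu a -> value_group nu b -> (f a <= f b) = (a <= b).
Hypothesis S_ge0 : forall s, S s -> val_ge nu f 0 s.

(** The remainder [a * x ^+ t + b * y] of [expand_mod] equals [j u * (a * g) + j v * b]. Expanding
    [a * g] and [b] in turn keeps the coefficients in [R], as [u] and [v] lie there, and each round
    adds [c] to the lower bound for the value of the remainder. *)
Lemma expand_approx (u v : K) (g : F) (t : nat) (c : rat) :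
  R u -> R v -> S g -> S x -> S y -> x ^+ t = j u * g -> y = j v ->
  val_ge nu f c (j u) -> val_ge nu f c (j v) ->
  forall N s, S s -> exists r : nat -> 'I_n -> K, exists h,
    [/\ forall i l, R (r i l), val_ge nu f (c *+ N) h &
        s = \sum_(i < t) x ^+ i * comb (r i) + h].
Proof.
move=> Ru Rv Sg Sx Sy xu yv cu cv; elim=> [|N IH] s Ss.
  exists (fun _ _ => 0), s; split => //; first by move=> *; exact: subring0.
    exact: S_ge0.
  rewrite big1 ?add0r // => i _; rewrite /comb big1 ?mulr0 // => l _.
  by rewrite rmorph0 mul0r.
have [r [a [b [Rr Sa Sb ->]]]] := expand_mod t Sy Sx Ss.
have [r1 [h1 [Rr1 vh1 e1]]] := IH _ (subringM sS Sa Sg).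
have [r2 [h2 [Rr2 vh2 e2]]] := IH _ Sb.
exists (fun i l => r i l + (u * r1 i l + v * r2 i l)), (j u * h1 + j v * h2).
split.
- by move=> i l; do !apply: subringD => //; apply: subringM.
- by rewrite mulrS; apply: val_geD => //; apply: val_geM.
rewrite xu yv mulrCA e1 e2.
under [in RHS]eq_bigr => i _.
  rewrite combD combD !combZ !mulrDr.
  rewrite [x ^+ i * (j u * _)]mulrCA [x ^+ i * (j v * _)]mulrCA.
  over.
rewrite !big_split /= -!mulr_sumr; ring.
Qed.

(** Dividing by a coefficient [r k] of least value puts all coefficients into the valuation ring and
    makes the [k]-th one 1. The resulting combination of the [e l] has nonzero residue, because the
    residues of the [e l] are independent; hence it has value 0. *)
Lemma comb_value (r : 'I_n -> K) :
  (forall l, e l \in valring nu) ->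
  lin_indep_over (@residue_image _ _ nu
    [set j a | a in [set` valring (restrict_valuation j nu)]])
    (fun l => residue nu (e l)) ->
  (forall l, r l = 0) \/
  exists2 l, r l != 0 & comb r != 0 /\ f (nu (comb r)) = f (nu (j (r l))).
Proof.
move=> Ve ind.
have [l0 rl0|r0] := pickP (fun l => r l != 0); last first.
  by left=> l; apply/eqP; rewrite -[_ == _]negbK r0.
right; pose k := [arg min_(l < l0 | r l != 0) f (nu (j (r l)))]%O.
have [rk0 kmin] : r k != 0 /\
    forall l, r l != 0 -> f (nu (j (r k))) <= f (nu (j (r l))).
  by rewrite /k; case: arg_minP.
exists k => //; have jrk0 : j (r k) != 0 by rewrite fmorph_eq0.
pose q l := r l / r k.
have Vq l : j (q l) \in valring nu.
  apply/(in_valring fD f_le); rewrite /q.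
  have [->|rl0'] := eqVneq (r l) 0; first by left; rewrite mul0r rmorph0.
  right; rewrite fmorph_div (ratvalM fD) ?invr_eq0 ?fmorph_eq0 // (ratvalV fD) //.
  by have := kmin _ rl0'; lra.
have Vqe l : j (q l) * e l \in valring nu by apply: rpredM.
have Vcq : comb q \in valring nu by apply: rpred_sum.
have ->: comb r = j (r k) * comb q.
  by rewrite -combZ; apply: eq_bigr => l _; rewrite /q [r k * _]mulrC divfK.
have [z|] := eqVneq (residue nu (comb q)) 0; last first.
  move=> /eqP; rewrite (residue_eq0P fD f_le Vcq) => nz.
  have [cq0|cq0] := eqVneq (comb q) 0; first by case: nz; left.
  rewrite mulf_neq0 // (ratvalM fD) //; split => //.
  move: Vcq => /(in_valring fD f_le)[/eqP|h]; first by rewrite (negPf cq0).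
  have : ~ 0 < f (nu (comb q)) by move=> h'; apply: nz; right.
  by lra.
have/(_ k) : forall l, residue nu (j (q l)) = 0.
  apply: ind.
    move=> l; exists (j (q l)) => //; exists (q l) => //.
    by move: (Vq l); rewrite /= !valringE fmorph_eq0.
  transitivity (residue nu (comb q)); last exact: z.
  rewrite /comb residue_sum //; apply: eq_bigr => l _; apply/esym.
  exact: residueM.
rewrite /q divff // rmorph1 residue1 => /eqP; by rewrite oner_eq0.
Qed.

End Expansion.

(** * Images of rings in the residue field *)

Lemma is_subring_image (K F : fieldType) (j : {rmorphism K -> F}) (R : set K) :
  is_subring R -> is_subring [set j a | a in R].
Proof.
move=> sR; split=> [|_ _ /set_mem[a Ra <-] /set_mem[b Rb <-]|
  _ _ /set_mem[a Ra <-] /set_mem[b Rb <-]]; apply: mem_set.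
- by exists 1; [exact: subring1|exact: rmorph1].
- by exists (a - b); [exact: subringB|exact: rmorphB].
- by exists (a * b); [exact: subringM|exact: rmorphM].
Qed.

Lemma is_subring_residue (F : fieldType) (G : orderedZmodType)
    (nu : valuation F G) (A : set F) :
  is_subring A -> A `<=` [set` valring nu] ->
  is_subring (@residue_image _ _ nu A).
Proof.
move=> sA AV; split=> [|_ _ /set_mem[a Aa <-] /set_mem[b Ab <-]|
  _ _ /set_mem[a Aa <-] /set_mem[b Ab <-]]; apply: mem_set.
- by exists 1; [exact: subring1|exact: residue1].
- exists (a - b); first exact: subringB.
  by apply: residueB; exact: AV.
- exists (a * b); first exact: subringM.
  by apply: residueM; exact: AV.
Qed.

(** A nonunit of [A] has residue 0, so an element with nonzero residue is inverted inside [A]. *)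
Lemma residue_dominated_inv (F : fieldType) (G : orderedZmodType)
    (nu : valuation F G) (f : G -> rat) (A : set F) :
  (forall a b, value_group nu a -> value_group nu b -> f (a + b) = f a + f b) ->
  (forall a b, value_group nu a -> value_group nu b ->
    (f a <= f b) = (a <= b)) ->
  is_subring A -> A `<=` [set` valring nu] ->
  max_ideal A `<=` max_ideal [set` valring nu] ->
  forall c, @residue_image _ _ nu A c -> @residue_image _ _ nu A c^-1.
Proof.
move=> fD f_le sA AV mAV _ [a Aa <-].
have [->|a0] := eqVneq (residue nu a) 0.
  by exists 0; rewrite ?residue0 ?invr0 //; exact: subring0.
have [[an0 _ Aai]|nua] := pselect (is_unit_of A a); last first.
  have /mAV/(max_ideal_valring fD f_le) : max_ideal A a by apply/max_idealP.
  by move=> /(residue_eq0P fD f_le (AV _ Aa))/eqP; rewrite (negPf a0).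
exists a^-1 => //; apply: (mulfI a0).
rewrite divff // -residueM ?divff ?residue1 //; exact: AV.
Qed.

(** * Multiples of the value of [x] modulo the value group of [K] *)

Lemma valuationX (F : fieldType) (G : orderedZmodType) (nu : valuation F G) x n :
  x != 0 -> nu (x ^+ n) = nu x *+ n.
Proof.
move=> x0; elim: n => [|n IH]; first by rewrite valuation1.
by rewrite exprS valuationM ?expf_neq0 // IH mulrS.
Qed.

Lemma valuationV (F : fieldType) (G : orderedZmodType) (nu : valuation F G) x :
  x != 0 -> nu x^-1 = - nu x.
Proof.
move=> x0; apply/eqP; rewrite -addr_eq0 addrC -valuationM ?invr_eq0 //.
by rewrite divff // valuation1.
Qed.

(** The exponent matrix is diagonal with entries [t] and 1. *)
Lemma exponent_matrix_lattice t (b : 'cV[int]_2) :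
  [set (exponent_matrix t)^T *m c | c in setT] b -> (t%:Z %| (b 0 0)%R)%Z.
Proof.
move=> [c _ <-]; rewrite !mxE big_ord_recl big_ord_recl big_ord0 !mxE /=.
by rewrite mul0r !addr0 mulrC dvdz_mull.
Qed.

(** Equality of the values makes [i - l] times the value of [x] equal to the value of [b' / b]. So
    the vector with entries [i - l] and 0 lies in the lattice of the exponent matrix, and [t]
    divides [i - l], whose absolute value is less than [t]. *)
Lemma exponents_distinct (K F : fieldType) (j : {rmorphism K -> F})
    (G : orderedZmodType) (nustar : valuation F G) (x y : F)
    (t i l : nat) (b b' : K) :
  (forall c : 'cV[int]_2,
    value_group (restrict_valuation j nustar)
      (nustar x *~ c 0 0 + nustar y *~ c 1 0) ->
    [set (exponent_matrix t)^T *m d | d in setT] c) ->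
  x != 0 -> b != 0 -> b' != 0 -> (i < t)%N -> (l < t)%N ->
  nustar (x ^+ i * j b) = nustar (x ^+ l * j b') -> i = l.
Proof.
move=> inj x0 b0 b'0 it lt.
rewrite !valuationM ?expf_neq0 ?fmorph_eq0 // !valuationX // => E.
pose c : 'cV[int]_2 := \col_k (if k == 0 then i%:Z - l%:Z else 0).
have /inj/exponent_matrix_lattice : value_group (restrict_valuation j nustar)
    (nustar x *~ c 0 0 + nustar y *~ c 1 0).
  exists (b' / b); first by rewrite /= mulf_neq0 ?invr_eq0.
  rewrite !mxE /= mulr0z addr0 mulrzBr fmorph_div.
  rewrite valuationM ?invr_eq0 ?fmorph_eq0 // valuationV ?fmorph_eq0 //.
  by apply/eqP; rewrite -!pmulrn subr_eq addrAC E addrAC subrr add0r.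
rewrite mxE eqxx => /dvdzP[q qE].
have [q0|q0|q0] := ltgtP q 0; [nia|nia|].
by move: qE; rewrite q0 mul0r; lia.
Qed.

(** * A basis of the residue field extension, and the values of expansions *)

Section Expansions.
Variables (K F : fieldType) (j : {rmorphism K -> F}).
Variables (G : orderedZmodType) (nustar : valuation F G).
Local Notation nu := (restrict_valuation j nustar).
Variable f : G -> rat.
Hypothesis fD : forall a b,
  value_group nustar a -> value_group nustar b -> f (a + b) = f a + f b.
Hypothesis f_le : forall a b,
  value_group nustar a -> value_group nustar b -> (f a <= f b) = (a <= b).
Variables (R : set K) (S : set F).
Local Notation C := (@residue_image _ _ nustar [set j a | a in R]).
Local Notation A :=
  (@residue_image _ _ nustar [set j a | a in [set` valring nu]]).

Lemma dominated_residue_subfield :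
  is_subring R -> dominates S [set j a | a in R] ->
  dominates [set` valring nustar] S ->
  is_subring C /\ (forall c, C c -> C c^-1).
Proof.
move=> sR [RS mRS] [SV mSV].
have sjR := is_subring_image j sR.
have RV := subset_trans RS SV.
split; first exact: is_subring_residue sjR RV.
apply: (residue_dominated_inv fD f_le sjR RV).
by rewrite -mRS -mSV => a [[]].
Qed.

(** The bound [M] yields an independent family of greatest length. It spans, since a residue outside
    its span could be prepended; lifting the coefficients to [R] gives [r]. *)
Lemma residue_basis (M : nat) :
  is_subring R -> is_subring S ->
  dominates S [set j a | a in R] -> dominates [set` valring nustar] S ->
  (forall n (e : 'I_n -> F), (forall l, S (e l)) ->
     lin_indep_over C (residue nustar \o e) -> (n <= M)%N) ->
  exists n (e : 'I_n -> F), [/\ forall l, S (e l),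
    lin_indep_over C (residue nustar \o e) &
    forall s, S s -> exists2 r, (forall l, R (r l)) &
      residue nustar s = residue nustar (comb j e r)].
Proof.
move=> sR sS domSR domVS bound.
have [sC CV] := dominated_residue_subfield sR domSR domVS.
have [RS _] := domSR; have [SV _] := domVS.
have RV := subset_trans RS SV.
pose P n := `[< exists e : 'I_n -> F, (forall l, S (e l)) /\
  lin_indep_over C (residue nustar \o e) >].
have exP : exists n, P n.
  exists 0; apply/asboolP; exists (fun=> 0).
  by split=> [l|c _ _ []//]; exact: subring0.
have [n /asboolP[e [Se ind]] n_max] := @ex_maxnP P M exP
  (fun n Pn => let: ex_intro e (conj Se ind) := asboolW Pn in bound n e Se ind).
exists n, e; split=> // s Ss.
have [[c Cc sc]|nspan] :=
    pselect (in_span C (residue nustar \o e) (residue nustar s)).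
  have /choice[r rP] : forall l, exists r, R r /\ residue nustar (j r) = c l.
    by move=> l; have [_ [r Rr <-] <-] := Cc l; exists r.
  exists r; first by move=> l; have [] := rP l.
  have Vr l : j (r l) \in valring nustar.
    by apply: RV; exists (r l) => //; case: (rP l).
  have Ve l : e l \in valring nustar by apply: SV.
  rewrite residue_sum; last by move=> l; apply: rpredM.
  by rewrite sc; apply: eq_bigr => l _; rewrite residueM //; case: (rP l) => _ ->.
suff /n_max : P n.+1 by rewrite ltnn.
apply/asboolP; exists (fcons s e); split; first exact: fcons_ind.
suff -> : residue nustar \o fcons s e =
    fcons (residue nustar s) (residue nustar \o e).
  exact: lin_indep_fcons.
by apply: funext => i /=; rewrite /fcons; case: unlift.
Qed.

(** Each nonzero summand has the value of some [x ^+ i * j (r i l)] by [comb_value]. For different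
    [i < t] these values differ by [exponents_distinct], so the sum takes the value of a single
    summand. *)
Lemma expansion_value (x y : F) (t n : nat) (e : 'I_n -> F)
    (r : nat -> 'I_n -> K) :
  (forall c : 'cV[int]_2,
    value_group nu (nustar x *~ c 0 0 + nustar y *~ c 1 0) ->
    [set (exponent_matrix t)^T *m d | d in setT] c) ->
  x != 0 -> (forall l, e l \in valring nustar) ->
  lin_indep_over A (residue nustar \o e) ->
  \sum_(i < t) x ^+ i * comb j e (r i) != 0 ->
  exists (i : 'I_t) l, r i l != 0 /\
    nustar (\sum_(i < t) x ^+ i * comb j e (r i)) = nustar (x ^+ i * j (r i l)).
Proof.
move=> iso_inj x0 Ve ind D0.
pose a (i : 'I_t) := x ^+ i * comb j e (r i).
have a_val i : a i != 0 -> exists2 l, r i l != 0 &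
    f (nustar (a i)) = f (nustar (x ^+ i * j (r i l))).
  rewrite mulf_eq0 negb_or => /andP[xi0 ri0].
  have [r0|[l rl0 [_ E]]] := comb_value fD f_le (r i) Ve ind.
    by case/eqP: ri0; rewrite /comb big1 // => l _; rewrite r0 rmorph0 mul0r.
  by exists l; rewrite // !(ratvalM fD) ?E ?fmorph_eq0.
have a_inj : {in index_enum 'I_t &, forall i l, a i != 0 -> a l != 0 ->
    f (nustar (a i)) = f (nustar (a l)) -> i = l}.
  move=> i l _ _ /a_val[p rp0 ->] /a_val[q rq0 ->] /(ratval_inj f_le) E.
  apply/val_inj/(exponents_distinct iso_inj x0 rp0 rq0 (ltn_ord i) (ltn_ord l)).
  by apply: E; rewrite mulf_neq0 ?expf_neq0 ?fmorph_eq0.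
have [a0|[i _ [ai0 _ wi]]] :=
  distinct_values_sum f_le (index_enum_uniq _) a_inj.
  by case/eqP: D0; apply: big1 => i _; apply: a0; rewrite mem_index_enum.
have [l rl0 wl] := a_val _ ai0.
exists i, l; split=> //; apply: (ratval_inj f_le) => //.
  by rewrite mulf_neq0 ?expf_neq0 ?fmorph_eq0.
by rewrite wi wl.
Qed.

End Expansions.

(** By [comb_value] a combination of the [e l] over [K] vanishes only if all its coefficients do, so
    the [e l] are linearly independent over [K]. This supplies the bound for [residue_basis]. *)
Lemma residue_indep_dim (K : fieldType) (L : fieldExtType K)
    (G : orderedZmodType) (nustar : valuation L G) (f : G -> rat)
    (j : {rmorphism K -> L} := GRing.in_alg L) n (e : 'I_n -> L) :
  (forall a b, value_group nustar a -> value_group nustar b ->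
    f (a + b) = f a + f b) ->
  (forall a b, value_group nustar a -> value_group nustar b ->
    (f a <= f b) = (a <= b)) ->
  (forall l, e l \in valring nustar) ->
  lin_indep_over (@residue_image _ _ nustar
    [set j a | a in [set` valring (restrict_valuation j nustar)]])
    (residue nustar \o e) ->
  (n <= \dim {:L})%N.
Proof.
move=> fD f_le Ve ind.
suff /eqP : free [tuple e l | l < n].
  by rewrite size_tuple => <-; apply/dimvS/subvf.
apply/freeP => r r0.
have [//|[l _ [/eqP[]]]] := comb_value fD f_le r Ve ind.
rewrite -[RHS]r0; apply: eq_bigr => i _.
by rewrite -tnth_nth tnth_mktuple /j /= mulr_algl.
Qed.

(** * Finite generation of the value semigroup *)

Theorem corollary1p4
    (k : fieldType) (char0 : [pchar k] =i pred0)
    (K : fieldType) (iota : {rmorphism k -> K})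
    (Kstar : fieldExtType K) (Gamma : orderedZmodType)
    (nustar : valuation Kstar Gamma) (R : set K) (S : set Kstar) :
  let j : {rmorphism K -> Kstar} := GRing.in_alg Kstar in
  let nu : valuation K Gamma := restrict_valuation j nustar in
  function_field iota ->
  function_field (j \o iota) ->
  separable 1 {:Kstar} ->
  trivial_on nustar (j \o iota) ->
  rational_valuation nustar ->
  trdeg_is (residue nustar \o (j \o iota)) 0 ->
  (exists d e : nat, [/\ trdeg_is (j \o iota) d,
     trdeg_is (residue nustar \o (j \o iota)) e & d = (e + 2)%N]) ->
  algebraic_local_ring iota R ->
  algebraic_local_ring (j \o iota) S ->
  dominates S [set j a | a in R] ->
  dominates [set` valring nustar] S ->
  stable j nustar R S ->
  exists T : set Gamma,
    [/\ finite_set T, T `<=` value_semigroup nustar S &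
        value_semigroup nustar S =
        \bigcup_(tau in T) [set tau + s | s in value_semigroup nu R]].
Proof.
move=> j nu _ _ _ _ [f fD f_le] _ _ _ _ domSR domVS.
move=> [[u [v [x [y [t sm]]]]] st].
(* Stability is applied to the empty products, so that [R1] is [R] and [S1] is [S]; [iso_inj] is the
   injectivity of the lattice quotient into the quotient of the value groups. *)
have [[_ _ iso_inj _] _ ld] :=
  st R S u v x y t (MonoidalNil _ _) (MonoidalNil _ _) domSR sm.
have [[[[sR _] _ _ _ _] mR] [[[sS _] _ _ _ _] mS] t_gt0
  [g [g0 Sg Sgi] ju] jv] := sm.
have x0 : x != 0.
  by apply: (regular_parameter_neq0 fD f_le domVS (y := y)); case: sm.
have y0 : y != 0.
  apply: (regular_parameter_neq0 fD f_le domVS (y := x)).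
  by case: sm => _ [? mS' _ _ _]; split; rewrite // setUC.
have [mx my] : max_ideal S x /\ max_ideal S y.
  by rewrite mS; split; apply: sub_gen_smallest; [left|right].
have [Sx [/eqP|wx]] := (dominated_max_idealP fD f_le domVS x).1 mx.
  by rewrite (negPf x0).
have [Sy [/eqP|wy]] := (dominated_max_idealP fD f_le domVS y).1 my.
  by rewrite (negPf y0).
have [Ru Rv] : R u /\ R v.
  suff sub : max_ideal R `<=` R.
    by split; apply: sub; rewrite mR; apply: sub_gen_smallest; [left|right].
  by move=> a /(max_idealP sR)[].
have [SR _] := domSR; have [VS _] := domVS.
have SjR a : R a -> S (j a) by move=> Ra; apply: SR; exists a.
have Vge0 := dominated_val_ge0 fD f_le domVS.
have wju : 0 < f (nustar (j u)).
  rewrite ju (ratvalM fD) ?expf_neq0 // (ratvalX fD) //.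
  have : 0 < f (nustar x) *+ t by rewrite pmulrn_lgt0.
  by case: (Vge0 g Sg) => [/eqP|]; [rewrite (negPf g0)|lra].
have wjv : 0 < f (nustar (j v)) by rewrite jv.
have [sC CV] := dominated_residue_subfield fD f_le sR domSR domVS.
have CS : @residue_image _ _ nustar [set j a | a in R] `<=`
    @residue_image _ _ nustar S.
  by move=> _ [b /SR Sb <-]; exists b.
(* [ld] speaks of families of residues from the valuation ring of [nu], whereas the basis below
   consists of residues from [S]. *)
have ld' := linearly_disjoint_sym sC CV (is_subring_residue sS VS) CS ld.
(* Families independent over the residues of [R] are by [ld'] independent over the residue field of
   [nu], and their length is then at most the degree of [Kstar] over [K]. *)
have [|n [e [Se /ld' ind split_res]]] :=
    residue_basis fD f_le sR sS domSR domVS (M := \dim {:Kstar}).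
  move=> n e Se /ld' ind; apply: (residue_indep_dim fD f_le (e := e)).
    by move=> l; apply: VS.
  by apply: ind => l; exists (e l).
have {}ind := ind (fun l => ex_intro2 _ _ (e l) (Se l) erefl).
have Scomb r : (forall l, R (r l)) -> S (comb j e r).
  by move=> Rr; apply: subring_sum => // l; apply: subringM => //; exact: SjR.
(* Subtracting a combination with the same residue as [s] leaves an element of the maximal ideal of
   [S], which [x] and [y] generate. *)
have split_mod s : S s -> exists r a b,
    [/\ forall l, R (r l), S a, S b & s = comb j e r + a * x + b * y].
  move=> Ss; have [r Rr sr] := split_res s Ss.
  have Sd : S (s - comb j e r) by apply: subringB => //; exact: Scomb.
  have /(residue_eq0P fD f_le (VS _ Sd)) d0 : residue nustar (s - comb j e r) = 0.
    by rewrite residueB ?sr ?subrr //; apply: VS => //; exact: Scomb.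
  have := (dominated_max_idealP fD f_le domVS _).2 (conj Sd d0).
  rewrite mS => /(ideal_span2P sS Sx Sy)[a [b [Sa Sb eab]]].
  by exists r, a, b; split => //; rewrite -addrA -eab addrC subrK.
have xt : x ^+ t = j u * g^-1 by rewrite ju mulrAC divff // mul1r.
(* This is the gain in value per round of [expand_approx]; it is positive because [j u] and [j v]
   have positive value. *)
pose c := Order.min (f (nustar (j u))) (f (nustar (j v))).
have c0 : 0 < c by rewrite lt_min wju.
have cu : val_ge nustar f c (j u) by right; rewrite ge_min lexx.
have cv : val_ge nustar f c (j v) by right; rewrite ge_min lexx orbT.
have approx := expand_approx sR sS split_mod fD f_le Vge0
  Ru Rv Sgi Sx Sy xt (esym jv) cu cv.
have Ve l : e l \in valring nustar by apply: VS.
exists [set nustar (x ^+ i) | i in `I_t]; split.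
- exact/finite_image/finite_II.
- move=> _ [i _ <-]; exists (x ^+ i) => //.
  by split; [exact: subringX|apply/eqP; rewrite expf_neq0].
apply/seteqP; split; last first.
  move=> _ [_ [i it <-] [_ [r [Rr /= /eqP r0] <-] <-]].
  exists (x ^+ i * j r); last by rewrite valuationM ?expf_neq0 ?fmorph_eq0.
  split; first by apply: subringM => //; [exact: subringX|exact: SjR].
  by apply/eqP; rewrite mulf_neq0 ?expf_neq0 ?fmorph_eq0.
move=> _ [s [Ss /= /eqP s0] <-].
(* With [N] this large the remainder [h] has greater value than [s], so the truncated expansion [D]
   is nonzero and has the value of [s]. *)
have [N wsN] := ratval_archimedean nustar f s c0.
have [r [h [Rr vh es]]] := approx N s Ss.
set D := \sum_(i < t) _ in es.
have [D0 wD] : D != 0 /\ f (nustar D) = f (nustar s).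
  have -> : D = s - h by rewrite es addrK.
  apply: (ratval_addl f_le s0).
  case: vh => [->|vh]; [left; exact: oppr0|right].
  by rewrite valuationN; lra.
have [i [l [rl0]]] := expansion_value fD f_le iso_inj x0 Ve ind D0.
rewrite -(ratval_inj f_le D0 s0 wD) => ->.
exists (nustar (x ^+ i)); first by exists i => //=; exact: ltn_ord.
exists (nu (r i l)); first by exists (r i l) => //; split => //; apply/eqP.
by rewrite -[nu _]/(nustar (j (r i l))) -valuationM ?expf_neq0 ?fmorph_eq0.
Qed.
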